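(* Let $n\ge1$. The set ${\sf NL}_n=\{(\mu,\nu,\lambda)\in{\sf Par}_n^3:N_{\mu,\nu,\lambda}>0\}$ is a semigroup under componentwise addition. Moreover, ${\sf LR}_n=\{(\mu,\nu,\lambda)\in{\sf Par}_n^3:c_{\mu,\nu}^{\lambda}>0\}$ is a subsemigroup of ${\sf NL}_n$.
   Context: ${\sf Par}_n=\{(\lambda_1,\ldots,\lambda_n)\in{\mathbb Z}_{\ge0}^n:\lambda_1\ge\cdots\ge\lambda_n\}$. With $c_{\alpha,\beta}^{\mu}$ the Littlewood-Richardson coefficient ($s_\alpha s_\beta=\sum_\mu c_{\alpha,\beta}^\mu s_\mu$), the Newell-Littlewood number is $$N_{\mu,\nu,\lambda}=\sum_{\alpha,\beta,\gamma} c_{\alpha,\beta}^{\mu}c_{\alpha,\gamma}^{\nu}c_{\beta,\gamma}^{\lambda},$$ the sum over all triples of partitions (finitely many nonzero terms). Partitions are added coordinatewise. *)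

(* Defs.v *)
From HB Require Import structures.
From mathcomp Require Import all_boot all_order all_algebra.
From mathcomp Require Import boolp classical_sets fsbigop.
From mathcomp Require Import mpoly.

Set Implicit Arguments.
Unset Strict Implicit.
Unset Printing Implicit Defensive.

Import Order.TTheory GRing.Theory Num.Theory.
Local Open Scope classical_set_scope.
Local Open Scope ring_scope.

(* Partitions of arbitrary length, as weakly decreasing sequences of positive
   parts (no trailing zeros). *)
Definition is_part (s : seq nat) : bool := sorted geq s && (0%N \notin s).

Record intpart := IntPart { parts :> seq nat; partsP : is_part parts }.
HB.instance Definition _ := [isSub of intpart for parts].
HB.instance Definition _ := [Choice of intpart by <:].

(* The boxes of the Young diagram; rows and columns are numbered from 0. *)
Definition cell (s : intpart) := {i : 'I_(size s) & 'I_(nth 0%N s i)}.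
Definition row (s : intpart) (c : cell s) : nat := tag c.
Definition col (s : intpart) (c : cell s) : nat := tagged c.

(* Semistandard: weakly increasing along rows, strictly down columns. *)
Definition semistandard (k : nat) (s : intpart) (T : {ffun cell s -> 'I_k})
    : bool :=
  [forall c, forall d,
     ((row c == row d) && (col c <= col d)%N ==> (T c <= T d)%N) &&
     ((col c == col d) && (row c < row d)%N ==> (T c < T d)%N)].

(* The Schur function restricted to k variables. *)
Definition schur (k : nat) (s : intpart) : {mpoly int[k]} :=
  \sum_(T : {ffun cell s -> 'I_k} | semistandard T) \prod_(c : cell s) 'X_(T c).

(* s_a s_b = \sum_m c_m s_m in the ring of symmetric functions: the identity is
   required in every finite number k of variables. The index m ranges over all
   partitions. Note that \sum_(m \in A) is 0 by convention when infinitely many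
   terms are nonzero; since s_a s_b does not vanish for large k, a family c
   satisfying this predicate is a genuine finite expansion, hence unique because
   the Schur functions are linearly independent. *)
Definition schur_expansion (a b : intpart) (c : intpart -> int) : Prop :=
  forall k : nat,
    schur k a * schur k b = \sum_(m \in [set: intpart]) (schur k m *~ c m).

(* LRcoef a b m is c_{a,b}^m. Such a family of integers exists, the Schur
   functions being a Z-basis of the ring of symmetric functions, so the default
   value 0 is never used. *)
Definition LRcoef (a b : intpart) : intpart -> int :=
  xget (fun=> 0) [set c | schur_expansion a b c].

Definition NLnumber (mu nu la : intpart) : int :=
  \sum_(t \in [set: intpart * intpart * intpart])
    (let: (a, b, g) := t in LRcoef a b mu * LRcoef a g nu * LRcoef b g la).

Section Par.
Variable n : nat.

Definition nonincreasing : {pred {ffun 'I_n -> nat}} :=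
  fun f => [forall i : 'I_n, forall j : 'I_n, (i <= j)%N ==> (f j <= f i)%N].

Lemma nonincreasing_closed : Algebra.nmod_closed nonincreasing.
Proof.
split=> [|f g /forallP hf /forallP hg].
  by apply/forallP=> i; apply/forallP=> j; rewrite !ffunE leqnn implybT.
apply/forallP=> i; apply/forallP=> j; apply/implyP=> ij; rewrite !ffunE.
by apply: leq_add; [move/forallP: (hf i) | move/forallP: (hg i)];
  move=> /(_ j) /implyP; apply.
Qed.

(* Par_n, with the coordinatewise addition inherited from {ffun 'I_n -> nat}. *)
Record Par := MkPar { coords :> {ffun 'I_n -> nat};
                      coordsP : nonincreasing coords }.
HB.instance Definition _ := [isSub of Par for coords].
HB.instance Definition _ := [Choice of Par by <:].
HB.instance Definition _ :=
  GRing.SubChoice_isSubNmodule.Build {ffun 'I_n -> nat} nonincreasing Par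
    nonincreasing_closed.

Lemma strip_is_part (la : Par) :
  is_part [seq x <- [seq la i | i <- enum 'I_n] | x != 0%N].
Proof.
apply/andP; split; last by rewrite mem_filter.
apply: sorted_filter; first by move=> x y z /= xy yz; apply: leq_trans yz xy.
apply/(sortedP 0%N) => i; rewrite size_map size_enum_ord => ltin.
have lti : (i < n)%N by apply: ltnW.
pose oi := Ordinal lti; pose oj := Ordinal ltin.
have nthE (k : 'I_n) : nth 0%N [seq la i | i <- enum 'I_n] k = la k.
  by rewrite (nth_map k 0%N la) ?size_enum_ord // nth_ord_enum.
rewrite (nthE oi) (nthE oj).
have /forallP/(_ oi)/forallP/(_ oj)/implyP := coordsP la.
by apply; rewrite /= leqnSn.
Qed.

(* The partition underlying an element of Par_n: trailing zeros removed. *)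
Definition strip (la : Par) : intpart := IntPart (strip_is_part la).

Definition NL : {pred Par * Par * Par} :=
  fun t => let: (mu, nu, la) := t in
    0 < NLnumber (strip mu) (strip nu) (strip la).

Definition LR : {pred Par * Par * Par} :=
  fun t => let: (mu, nu, la) := t in
    0 < LRcoef (strip mu) (strip nu) (strip la).

End Par.

Arguments NL : clear implicits.
Arguments LR : clear implicits.

(* Main.v *)
From mathcomp Require Import all_boot all_order all_algebra all_fingroup.
From mathcomp Require Import boolp classical_sets cardinality fsbigop.
From mathcomp Require Import finmap mpoly zify.
Require Import Defs.

(** Semistandard tableaux with entries below [k] are the same thing as
    triangular (Gelfand-Tsetlin) arrays [g], where [g l r] is the number of
    entries smaller than [l] in row [r]. The theorem rests on a form of the
    Littlewood-Richardson rule in which the coefficient of [s_m] in [s_a s_b]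
    counts the arrays of shape [b] and weight [m - a] that satisfy a family of
    linear inequalities ([good]). All the conditions on [(a, b, m)] and on the
    array are linear, so the sum of an array for [(a, b, m)] and one for
    [(a', b', m')] is an array for the sum of the two triples: positivity of
    Littlewood-Richardson coefficients is preserved by addition
    ([LRcoef_gt0], [LRcoef_add]).

    The rule is proved by a sign-reversing involution in the style of
    Stembridge. Let [A(e)] be the alternant with exponent vector [e], and let
    [rho] be the vector with coordinates [k - i]. The Bender-Knuth involution,
    which is piecewise linear on arrays, shows that Schur polynomials are
    symmetric ([schur_sym]), whence [s_b A(a + rho)] is the sum of
    [A(a + weight T + rho)] over all tableaux [T] of shape [b]
    ([sym_alternant]). If the array of [T] violates one of the inequalities, a
    truncated Bender-Knuth move at the first violation exchanges two
    coordinates of [a + weight T + rho], so the bad tableaux cancel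
    ([schur_alternant]). With [a = 0] there is a single good tableau, and
    [s_b A(rho) = A(b + rho)] ([schur_vandermonde]); dividing by [A(rho)] gives
    the rule ([schur_mul]). Coefficients of alternants separate partitions, so
    the expansion of [s_a s_b] is unique, and its coefficients are these
    numbers of tableaux ([LRcoefE]).

    A Newell-Littlewood number is a finite sum of nonnegative terms, hence it is
    positive if and only if three Littlewood-Richardson coefficients are
    ([NLnumber_gt0]). Closure under addition follows termwise. Finally, the term
    indexed by the empty partition, [mu] and [nu] of [N_(mu, nu, la)] is a
    positive multiple of [c_(mu, nu)^la] ([LRcoef_empty]). *)

Set Implicit Arguments.
Unset Strict Implicit.
Unset Printing Implicit Defensive.

Import GRing.Theory Num.Theory.

(** * Triangular arrays *)

(** Triangular arrays of shape [f]: level [l] is the partition formed by the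
    entries smaller than [l], and consecutive levels interlace. The levels are
    indexed by all natural numbers and are constant from level [k] on, so that
    a pattern for [k] is also one for every larger bound. *)
Definition pattern (k : nat) (f : nat -> nat) (g : nat -> nat -> nat) : Prop :=
  [/\ forall r, g 0 r = 0,
      forall l r, k <= l -> g l r = f r,
      forall l r, g l r <= g l.+1 r
    & forall l r, g l.+1 r.+1 <= g l r].

(** The number of entries smaller than [l] in the first [i] rows. *)
Definition rowsum (g : nat -> nat -> nat) (l i : nat) : nat :=
  \sum_(r < i) g l r.

(** The Littlewood-Richardson condition for the letters [v], [v + 1] and the
    row [i] requires that [lam (v + 1)] plus the number of letters [v + 1] in
    rows [0 .. i] be at most [lam v] plus the number of letters [v] in rows
    [0 .. i - 1]. The violation is written without subtraction. *)
Definition violates (lam : nat -> nat) (g : nat -> nat -> nat) (v i : nat) :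
  bool :=
  lam v + rowsum g v.+1 i.+1 + rowsum g v.+1 i <
  lam v.+1 + rowsum g v.+2 i.+1 + rowsum g v i.

(** An array is good for [lam] if it satisfies all these conditions. *)
Definition good lam g : Prop := forall v i, ~~ violates lam g v i.

Section PatternTheory.
Variables (k : nat) (f : nat -> nat) (g : nat -> nat -> nat).
Hypothesis gP : pattern k f g.

Lemma pattern_mono l l' r : l <= l' -> g l r <= g l' r.
Proof.
case: gP => _ _ g1 _ /subnK <-; elim: (l' - l) => // d IH.
by rewrite addSn; apply: leq_trans (g1 _ _).
Qed.

Lemma pattern_le l r : g l r <= f r.
Proof.
case: gP => _ gk _ _; rewrite -(gk (maxn k l)) ?leq_maxl //.
exact: pattern_mono (leq_maxr _ _).
Qed.

Lemma pattern_shape_mono : {homo f : r r' / r <= r' >-> r >= r'}.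
Proof.
case: gP => _ gk _ g2 r r' /subnK <-; elim: (r' - r) => // d IH.
rewrite addSn; apply: leq_trans IH.
by rewrite -(gk k.+1 _.+1) ?leqnSn // -(gk k) //.
Qed.

Lemma pattern_mono_row l r r' : r <= r' -> g l r' <= g l r.
Proof.
case: gP => _ _ g1 g2 /subnK <-; elim: (r' - r) => // d IH.
by rewrite addSn; apply: leq_trans IH; apply: leq_trans (g1 _ _) (g2 _ _).
Qed.

Lemma pattern_above l r : l <= r -> g l r = 0.
Proof.
case: gP => g0 _ _ g2; elim: l r => [|l IH] [|r] //= lr.
by apply/eqP; rewrite -leqn0 -(IH r lr) g2.
Qed.

End PatternTheory.

Lemma rowsumS g l i : rowsum g l i.+1 = rowsum g l i + g l i.
Proof. by rewrite /rowsum big_ord_recr. Qed.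

Lemma rowsum0 g l : rowsum g l 0 = 0.
Proof. by rewrite /rowsum big_ord0. Qed.

Lemma eq_rowsum g h l l' i : (forall r, r < i -> g l r = h l' r) ->
  rowsum g l i = rowsum h l' i.
Proof. by move=> e; apply: eq_bigr => r _; apply: e. Qed.

Lemma rowsumD g h l i :
  rowsum (fun l r => g l r + h l r) l i = rowsum g l i + rowsum h l i.
Proof. by rewrite /rowsum big_split. Qed.

Lemma rowsum_cst0 g l m N :
  (forall r, m <= r -> g l r = 0) -> m <= N -> rowsum g l N = rowsum g l m.
Proof.
move=> z /subnK <-; elim: (N - m) => // d IH.
by rewrite addSn rowsumS IH z ?addn0 // leq_addl.
Qed.

Lemma leq_rowsum k f g l l' i : pattern k f g -> l <= l' ->
  rowsum g l i <= rowsum g l' i.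
Proof.
by move=> gP ll; apply: leq_sum => r _; apply: (pattern_mono gP).
Qed.

Lemma patternD k f g f' g' : pattern k f g -> pattern k f' g' ->
  pattern k (fun r => f r + f' r) (fun l r => g l r + g' l r).
Proof.
move=> [a1 a2 a3 a4] [b1 b2 b3 b4]; split=> [r|l r kl|l r|l r].
- by rewrite a1 b1.
- by rewrite a2 ?b2.
- exact: leq_add.
- exact: leq_add.
Qed.

Lemma goodD lam g lam' g' : good lam g -> good lam' g' ->
  good (fun v => lam v + lam' v) (fun l r => g l r + g' l r).
Proof.
move=> h h' v i; move: (h v i) (h' v i); rewrite /violates !rowsumD; lia.
Qed.

(** The Bender-Knuth move on the letters [v] and [v + 1], restricted to the
    rows from [i] on: it reflects each entry of level [v + 1] in the interval
    left to it by the neighbouring levels, except that [U] is used as upper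
    bound in row [i]. *)
Definition flip (v i U : nat) (g : nat -> nat -> nat) (l r : nat) : nat :=
  if (l == v.+1) && (i <= r) then
    (if r == i then U else minn (g v.+2 r) (g v r.-1))
      + maxn (g v.+2 r.+1) (g v r) - g v.+1 r
  else g l r.

Section FlipValues.
Variables (v i U : nat) (g : nat -> nat -> nat).

Lemma flip_other l r : l != v.+1 -> flip v i U g l r = g l r.
Proof. by rewrite /flip => /negbTE ->. Qed.

Lemma flip_low l r : r < i -> flip v i U g l r = g l r.
Proof. by rewrite /flip => ri; rewrite (leqNgt i r) ri andbF. Qed.

Lemma flip_row r : r = i ->
  flip v i U g v.+1 r = U + maxn (g v.+2 r.+1) (g v r) - g v.+1 r.
Proof. by move=> ->; rewrite /flip eqxx leqnn /= eqxx. Qed.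

Lemma flip_high r : i < r -> flip v i U g v.+1 r =
  minn (g v.+2 r) (g v r.-1) + maxn (g v.+2 r.+1) (g v r) - g v.+1 r.
Proof. by move=> ir; rewrite /flip eqxx ltnW //= gtn_eqF. Qed.

End FlipValues.

Section Flip.
Variables (k : nat) (f : nat -> nat) (g : nat -> nat -> nat).
Hypothesis gP : pattern k f g.
Variables v i U : nat.
Hypothesis vk : v.+1 < k.
Hypothesis U1 : g v.+1 i <= U.
Hypothesis U2 : U <= g v.+2 i.
Hypothesis U3 : 0 < i -> U <= g v i.-1.

Lemma flip_pattern : pattern k f (flip v i U g).
Proof.
case: (gP) => g0 gk g1 g2.
have bnd r : [/\ g v r <= flip v i U g v.+1 r, flip v i U g v.+1 r <= g v.+2 r,
    g v.+2 r.+1 <= flip v i U g v.+1 r & flip v i U g v.+1 r.+1 <= g v r].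
  have e1 := g1 v r; have e2 := g1 v.+1 r; have e3 := g2 v.+1 r.
  have e4 := g2 v r; have e5 := g1 v r.+1; have e6 := g1 v.+1 r.+1.
  have e7 := g2 v.+1 r.+1.
  have h1 : [/\ g v r <= flip v i U g v.+1 r, flip v i U g v.+1 r <= g v.+2 r &
      g v.+2 r.+1 <= flip v i U g v.+1 r].
    case: (ltngtP r i) => [ri|ir|E].
    - by rewrite !flip_low.
    - rewrite flip_high //; case: r ir e1 e2 e3 e4 e5 e6 e7 => // r ir.
      by have /= := g2 v r; have /= := g2 v.+1 r; split; lia.
    - by rewrite flip_row // E in e1 e2 e3 *; split; lia.
  case: h1 => ? ? ?; split=> //.
  case: (ltngtP r.+1 i) => [ri|ir|E].
  - by rewrite flip_low.
  - by rewrite flip_high //=; lia.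
  - by rewrite flip_row // E; move: U3; rewrite -E /= in e4 e5 e6 e7 *; lia.
split=> [r|l r kl|l r|l r].
- by rewrite flip_other.
- by rewrite flip_other ?gk //; lia.
- have [E|nE] := eqVneq l v.+1.
    by subst l; rewrite [X in _ <= X]flip_other ?(gtn_eqF (leqnn _)) //;
      case: (bnd r).
  have [E|nE'] := eqVneq l v.
    by subst l; rewrite flip_other //; case: (bnd r).
  by rewrite !flip_other.
- have [E|nE] := eqVneq l v.+1.
    by subst l; rewrite [X in X <= _]flip_other ?(gtn_eqF (leqnn _)) //;
      case: (bnd r).
  have [E|nE'] := eqVneq l v.
    by subst l; rewrite [X in _ <= X]flip_other //; case: (bnd r).
  by rewrite !flip_other.
Qed.

Lemma flipK : flip v i U (flip v i U g) =2 g.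
Proof.
case: (gP) => g0 gk g1 g2 l r.
have [E|nE] := eqVneq l v.+1; last by rewrite !flip_other.
subst l; have n2 : v.+2 != v.+1 by lia.
have n0 : v != v.+1 by lia.
case: (ltngtP r i) => [ri|ir|E].
- by rewrite !flip_low.
- rewrite /flip eqxx (ltnW ir) /= (gtn_eqF ir) (negbTE n2) (negbTE n0) /=.
  case: r ir => // r ir /=; have := g1 v r.+1; have := g1 v.+1 r.+1.
  have := g2 v r; have := g2 v.+1 r.+1; lia.
- rewrite E /flip eqxx leqnn /= eqxx (negbTE n2) (negbTE n0) /=.
  have := g1 v i; have := g1 v.+1 i; have := g2 v.+1 i; lia.
Qed.

(** The sum of the upper and of the lower bounds telescopes, because
    [minn x y + maxn x y = x + y]. *)
Lemma flip_rowsum N : i < N -> g v.+2 N = 0 ->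
  rowsum (flip v i U g) v.+1 N + rowsum g v.+1 N + rowsum g v.+2 i.+1
    + rowsum g v i
  = 2 * rowsum g v.+1 i + U + rowsum g v.+2 N + rowsum g v N.
Proof.
case: (gP) => g0 gk g1 g2 iN aN.
(* In the partial sums the bounds pair up except for the last lower bound. *)
suff H d : rowsum (flip v i U g) v.+1 (i.+1 + d) + rowsum g v.+1 (i.+1 + d)
    + rowsum g v.+2 i.+1 + rowsum g v i
  = 2 * rowsum g v.+1 i + U + rowsum g v.+2 (i.+1 + d) + rowsum g v (i + d)
     + maxn (g v.+2 (i.+1 + d)) (g v (i + d)).
  have := H (N - i.+1); rewrite subnKC // aN max0n.
  have -> : i + (N - i.+1) = N.-1 by lia.
  by case: N iN {aN} => // N _ /=; rewrite (rowsumS g v N); lia.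
elim: d => [|d IH].
  rewrite !addn0 (rowsumS (flip _ _ _ _)) flip_row // (rowsumS g v.+1).
  rewrite (@eq_rowsum (flip v i U g) g v.+1 v.+1); last by move=> r ?;
    rewrite flip_low.
  have := g1 v i; have := g2 v.+1 i; lia.
rewrite !addnS !(rowsumS _ _ (i.+1 + d)) (rowsumS _ _ (i + d)).
rewrite flip_high ?ltnS ?leq_addr //= addSn /=.
have := g1 v (i + d).+1; have := g2 v.+1 (i + d).+1; have := g2 v (i + d).
by have := g1 v.+1 (i + d).+1; rewrite addSn in IH; lia.
Qed.

End Flip.

Section Violation.
Variables (k : nat) (f : nat -> nat) (g : nat -> nat -> nat) (lam : nat -> nat).
Hypothesis gP : pattern k f g.
Hypothesis lamP : forall v, lam v.+1 <= lam v.

(** Beyond the last letter the condition holds because [lam] is decreasing. *)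
Lemma violates_lt v i : violates lam g v i -> v.+1 < k.
Proof.
case: (gP) => g0 gk g1 g2; rewrite ltnNge; apply/contraL => kv.
rewrite /violates -leqNgt !rowsumS (gk v.+2) ?(gk v.+1) ?(leqW kv) //.
rewrite (@eq_rowsum g g v.+2 v.+1); last by move=> r _; rewrite !gk //; lia.
by have := lamP v; have := leq_rowsum i gP (leqnSn v); lia.
Qed.

(** The violation at [(v, i)] is the first one when violations are ordered by
    increasing row, then by decreasing letter. *)
Definition firstviol (g : nat -> nat -> nat) (v i : nat) : Prop :=
  [/\ violates lam g v i, forall v' i', i' < i -> ~~ violates lam g v' i'
    & forall v', v < v' -> ~~ violates lam g v' i].

Lemma firstviol_exists : ~ good lam g -> exists v i, firstviol g v i.
Proof.
move=> ng; have ex : exists i, `[< exists v, violates lam g v i >].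
  apply: contrapT => nex; apply: ng => v i; apply/negP => vi.
  by apply: nex; exists i; apply/asboolP; exists v.
case: (ex_minnP ex) => i /asboolP vi imin.
have bnd v : violates lam g v i -> v <= k by move/violates_lt; lia.
case: (ex_maxnP vi bnd) => v vv vmax; exists v, i; split=> //.
  move=> v' i' ii; apply/negP => vv'.
  by move: ii; rewrite ltnNge imin //; apply/asboolP; exists v'.
by move=> v' vv'; apply/negP => /vmax; rewrite leqNgt vv'.
Qed.

Lemma firstviol_uniq v i v' i' :
  firstviol g v i -> firstviol g v' i' -> (v, i) = (v', i').
Proof.
move=> [a1 a2 a3] [b1 b2 b3].
have E : i = i'.
  case: (ltngtP i i') => // ii; first by move: (b2 v _ ii); rewrite a1.
  by move: (a2 v' _ ii); rewrite b1.
subst i'; congr pair; case: (ltngtP v v') => // vv.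
  by move: (a3 _ vv); rewrite b1.
by move: (b3 _ vv); rewrite a1.
Qed.

End Violation.

(** The upper bound in row [i] for which [flip] exchanges the coordinates [v]
    and [v + 1] of [lam + weight + rho]. Its value depends only on the rows of
    level [v + 1] before [i], which [flip] leaves alone ([cap_flip]). *)
Definition cap (lam : nat -> nat) (g : nat -> nat -> nat) (v i : nat) : nat :=
  (lam v.+1 + rowsum g v.+2 i.+1 + rowsum g v i).-1
  - (lam v + 2 * rowsum g v.+1 i).

Section FlipViolation.
Variables (k : nat) (f : nat -> nat) (g : nat -> nat -> nat) (lam : nat -> nat).
Hypothesis gP : pattern k f g.
Hypothesis lamP : forall v, lam v.+1 <= lam v.
Variables v i : nat.
Hypothesis fv : firstviol lam g v i.
Let U := cap lam g v i.

Lemma firstviol_lt : v.+1 < k.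
Proof. by case: fv => /(violates_lt gP lamP). Qed.

(** The lower bound on [cap] holds because row [i] is a violation, the upper
    bounds because the row before it is not (if [i = 0], because [lam] is
    decreasing). *)
Lemma cap_bounds :
  [/\ g v.+1 i <= U, U < g v.+2 i & 0 < i -> U < g v i.-1].
Proof.
case: gP => g0 gk g1 g2; case: fv => + mini _.
rewrite /violates /U /cap !rowsumS => vi.
move: vi; have [-> |] := posnP i.
  by have := lamP v; rewrite !rowsum0; split; lia.
case: i mini => // j mini _ vi.
move: (mini v j (ltnSn j)) vi; rewrite /violates -leqNgt !rowsumS /= => nv vi.
have := g1 v j; have := g2 v.+1 j; split; lia.
Qed.

Lemma cap_flip : cap lam (flip v i U g) v i = U.
Proof.
rewrite /cap (@eq_rowsum _ g v.+2 v.+2) => [|r _];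
  last by rewrite flip_other //; lia.
rewrite (@eq_rowsum (flip _ _ _ _) g v v) => [|r _];
  last by rewrite flip_other //; lia.
by rewrite (@eq_rowsum (flip _ _ _ _) g v.+1 v.+1) // => r ri; rewrite flip_low.
Qed.

(** The order of violations is such that [flip] affects no earlier condition: at
    level [v + 1] it only changes rows from [i] on, and in row [i] this enters
    the conditions for the letters [v - 1] and [v] only. *)
Lemma flip_firstviol : firstviol lam (flip v i U g) v i.
Proof.
case: gP => g0 gk g1 g2; case: (fv) => vi mini maxv.
case: cap_bounds => U1 U2 U3.
have low l j : j <= i -> rowsum (flip v i U g) l j = rowsum g l j.
  by move=> ji; apply: eq_rowsum => r rj; apply/flip_low/(leq_trans rj ji).
have oth l j : l != v.+1 -> rowsum (flip v i U g) l j = rowsum g l j.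
  by move=> lv; apply: eq_rowsum => r rj; apply/flip_other.
split=> [|v' i' ii|v' vv].
- rewrite /violates (oth v.+2) ?(oth v); [|lia..].
  rewrite rowsumS !low // flip_row //.
  move: vi U1 U2; rewrite /violates /U /cap !rowsumS.
  by have := g1 v i; have := g2 v.+1 i; lia.
- by have := mini v' i' ii; rewrite /violates !low //; lia.
- have := maxv v' vv; rewrite /violates (oth v'.+2) ?(oth v'.+1); [|lia..].
  by rewrite low.
Qed.

Lemma flip_firstviol_pattern : pattern k f (flip v i U g).
Proof.
case: cap_bounds => U1 U2 U3.
exact: (flip_pattern gP firstviol_lt U1 (ltnW U2) (fun i0 => ltnW (U3 i0))).
Qed.

Lemma flip_firstviolK : flip v i U (flip v i U g) =2 g.
Proof.
case: cap_bounds => U1 U2 U3.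
exact: (flipK gP firstviol_lt U1 (ltnW U2) (fun i0 => ltnW (U3 i0))).
Qed.

(** With [N] at least the number of rows, this says that the coordinate [v] of
    [lam + weight + rho] becomes the old coordinate [v + 1]. *)
Lemma flip_firstviol_rowsum N : f N = 0 ->
  lam v + rowsum (flip v i U g) v.+1 N + rowsum g v.+1 N + 1 =
  lam v.+1 + rowsum g v.+2 N + rowsum g v N.
Proof.
case: cap_bounds => U1 U2 U3 fN; case: fv => vi _ _.
have z := pattern_le gP v.+2 N; have z' := pattern_le gP v.+2 i.
have iN : i < N.
  by rewrite ltnNge; apply/negP => /(pattern_shape_mono gP); lia.
have := flip_rowsum gP firstviol_lt U1.
move=> /(_ (ltnW U2) (fun i0 => ltnW (U3 i0)) N iN ltac:(lia)).
move: vi U1 U2; rewrite /violates /U /cap !rowsumS; lia.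
Qed.

End FlipViolation.

(** * Semistandard tableaux as triangular arrays *)

(** The parts of a partition, extended by zeros. *)
Definition part (s : intpart) (r : nat) : nat := nth 0 s r.

Lemma part_default (s : intpart) r : size s <= r -> part s r = 0.
Proof. exact: nth_default. Qed.

Lemma part_mono (s : intpart) : {homo part s : r r' / r <= r' >-> r >= r'}.
Proof.
move=> r r' rr; have [h|h] := leqP (size s) r';
  first by rewrite (part_default h).
have /andP[ss _] := partsP s.
have tr : transitive geq by move=> x y z /= h1 h2; apply: leq_trans h2 h1.
apply: (sorted_leq_nth tr leqnn 0 ss) => //; rewrite inE //.
exact: leq_ltn_trans h.
Qed.

Lemma part_gt0 (s : intpart) r : (0 < part s r) = (r < size s).
Proof.
have [h|h] := ltnP r (size s); last by rewrite part_default.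
have /andP[_ n0] := partsP s.
by rewrite lt0n; apply: contraNneq n0 => <-; apply: mem_nth.
Qed.

Lemma part_inj (s t : intpart) : part s =1 part t -> s = t.
Proof.
move=> st; apply: val_inj => /=.
have ss : size s = size t.
  have h r : (r < size s) = (r < size t) by rewrite -[LHS]part_gt0 st part_gt0.
  case: (ltngtP (size s) (size t)) => // lt; first by move: (h (size s));
    rewrite ltnn lt.
  by move: (h (size t)); rewrite ltnn lt.
by apply: (@eq_from_nth _ 0) => // r _; apply: st.
Qed.

Section Cells.
Variable s : intpart.

Lemma col_lt (x : cell s) : col x < part s (row x).
Proof. exact: (ltn_ord (tagged x)). Qed.

Lemma cell_at r c : c < part s r -> {x : cell s | row x = r & col x = c}.
Proof.
move=> cr; have rs : r < size s by rewrite -part_gt0; apply: leq_trans cr.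
by exists (Tagged (fun i : 'I_(size s) => 'I_(nth 0 s i))
  (Ordinal cr : 'I_(nth 0 s (Ordinal rs)))).
Qed.

Lemma cell_inj (x y : cell s) : row x = row y -> col x = col y -> x = y.
Proof.
case: x y => [i c] [j d]; rewrite /row /col /= => /ord_inj ij; subst j.
by move=> /ord_inj ->.
Qed.

Lemma sum_cells (F : nat -> nat -> nat) :
  \sum_(x : cell s) F (row x) (col x) =
  \sum_(r < size s) \sum_(c < part s r) F r c.
Proof.
by rewrite (sig_big_dep _ (fun i => xpredT)
  (fun (i : 'I_(size s)) (c : 'I_(part s i)) => F i c)).
Qed.

End Cells.

Section Count.
Variables (s : intpart) (k : nat).
Implicit Type T : {ffun cell s -> 'I_k}.

(** The entry in row [r] and column [c], or [k] outside the diagram. *)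
Definition entry T (r c : nat) : nat :=
  if [pick x : cell s | (row x == r) && (col x == c)] is Some x then T x else k.

Lemma entryE T x : entry T (row x) (col x) = T x.
Proof.
rewrite /entry; case: pickP => [y /andP[/eqP e1 /eqP e2]|/(_ x)].
  by rewrite (cell_inj e1 e2).
by rewrite !eqxx.
Qed.

Lemma entry_at T r c : c < part s r ->
  {x : cell s | row x = r /\ col x = c & entry T r c = T x}.
Proof.
by move=> /cell_at[x rx cx]; exists x => //; rewrite -entryE rx cx.
Qed.

(** The array of [T]: the number of entries smaller than [l] in row [r]. *)
Definition array T (l r : nat) : nat := \sum_(c < part s r) (entry T r c < l).

(** [g] is the array of [T]: the entries of row [r] smaller than [l] are
    exactly those in the first [g l r] columns. *)
Definition tableau_of (g : nat -> nat -> nat) T : Prop :=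
  forall x l, l <= k -> (T x < l) = (col x < g l (row x)).

(** The elements of an initial segment are those smaller than its size. *)
Lemma count_initial (P : pred nat) M :
  (forall c c', c <= c' -> c' < M -> P c' -> P c) ->
  forall c, c < M -> P c = (c < \sum_(i < M) P i).
Proof.
elim: M => // M IH mono c cM; rewrite big_ord_recr /=.
have mono' c1 c2 : c1 <= c2 -> c2 < M -> P c2 -> P c1.
  by move=> h1 h2; apply: mono => //; apply: ltnW.
have le m : \sum_(i < m) P i <= m.
  elim: m => [|m IHm]; first by rewrite big_ord0.
  by rewrite big_ord_recr /= -addn1 leq_add ?leq_b1.
case PM: (P M).
  have all c1 : c1 < M -> P c1.
    by move=> h; apply: (mono c1 M) => //; apply: ltnW.
  rewrite (eq_bigr (fun=> 1)); last by move=> i _; rewrite all.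
  rewrite sum1_card card_ord addn1 cM.
  by move: cM; rewrite ltnS leq_eqVlt => /orP[/eqP ->|/all].
rewrite /= addn0; move: cM; rewrite ltnS leq_eqVlt =>
  /orP[/eqP ->|/(IH mono')] //.
by rewrite PM; apply/esym/negbTE; rewrite -leqNgt; exact: le.
Qed.

Lemma count_lt M e : e <= M -> \sum_(c < M) (c < e) = e.
Proof.
elim: M => [|M IH] eM; first by rewrite big_ord0; lia.
rewrite big_ord_recr /=; case: ltnP => h; last by rewrite IH ?addn0.
rewrite (eq_bigr (fun=> 1)); last by move=> i _;
  rewrite (ltn_trans (ltn_ord i) h).
by rewrite sum1_card card_ord; lia.
Qed.

Lemma arrayP T : semistandard T -> tableau_of (array T) T.
Proof.
move=> /forallP ssT x l lk; rewrite -(entryE T x).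
apply: (count_initial (P := fun c => entry T (row x) c < l));
  last exact: col_lt.
move=> c c' cc' c's /=.
have [y ry cy] := cell_at c's.
have [z rz cz] := cell_at (leq_ltn_trans cc' c's).
rewrite -[in X in X -> _]ry -[in X in _ -> X]rz -cy -cz !entryE;
  apply: leq_ltn_trans.
by have /forallP/(_ y)/andP[/implyP h _] := ssT z; apply: h;
  rewrite ry rz cy cz eqxx.
Qed.

Lemma arrayE T g : pattern k (part s) g -> tableau_of g T ->
  forall l r, l <= k -> array T l r = g l r.
Proof.
move=> gP Tg l r lk; rewrite -[RHS](@count_lt (part s r)) ?(pattern_le gP) //.
apply: eq_bigr => c _; have [x [rx cx] ->] := entry_at T (ltn_ord c).
by rewrite Tg // rx cx.
Qed.

Lemma array_ge T l r : k <= l -> array T l r = part s r.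
Proof.
move=> kl; rewrite /array (eq_bigr (fun=> 1)) ?sum1_card ?card_ord // => c _.
have [x _ ->] := entry_at T (ltn_ord c).
by rewrite (leq_trans (ltn_ord _) kl).
Qed.

Lemma array_pattern T : semistandard T -> pattern k (part s) (array T).
Proof.
move=> ssT; split=> [r|l r kl|l r|l r].
- by rewrite /array big1.
- exact: array_ge.
- apply: leq_sum => c _; case: ltnP => // h; case: ltnP => //; lia.
have [kl|lk] := leqP k l.
  by rewrite !array_ge ?(leqW kl) // part_mono.
rewrite leqNgt; apply/negP => h.
have le l' r' : array T l' r' <= part s r'.
  rewrite /array -[X in _ <= X]card_ord -sum1_card leq_sum // => c _;
    exact: leq_b1.
have [y ry cy] := cell_at (leq_trans h (le _ _)).
have [x rx cx] :=
  cell_at (leq_trans (leq_trans h (le _ _)) (part_mono s (leqnSn r))).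
have := arrayP ssT x (ltnW lk); rewrite rx cx ltnn.
have := arrayP ssT y lk; rewrite ry cy h => yl /negbT; rewrite -leqNgt.
move/forallP: ssT => /(_ x)/forallP/(_ y)/andP[_ /implyP].
by rewrite rx ry cx cy eqxx ltnSn => /(_ isT); lia.
Qed.

Lemma tableau_exists g : pattern k (part s) g ->
  exists2 T, semistandard T & tableau_of g T.
Proof.
move=> gP; have ex (x : cell s) : exists l, (l < k) && (col x < g l.+1 (row x)).
  case: (gP) => g0 gk _ _;
  have xk : col x < g k (row x) by rewrite gk // col_lt.
  have k0 : 0 < k by rewrite lt0n; apply: contraTneq xk => ->; rewrite g0.
  by exists k.-1; rewrite prednK // leqnn.
have lt x : ex_minn (ex x) < k by case: ex_minnP => m /andP[].
pose T : {ffun cell s -> 'I_k} := [ffun x => Ordinal (lt x)].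
have TP : tableau_of g T.
  move=> x l lk; rewrite ffunE /=; case: ex_minnP => m /andP[mk hm] mmin.
  apply/idP/idP => [ml|h]; first exact: leq_trans (pattern_mono gP _ ml).
  case: l lk h => [|l] lk h; first by case: gP h => ->.
  by rewrite ltnS mmin // lk.
exists T => //; apply/forallP => x; apply/forallP => y; apply/andP; split.
  apply/implyP => /andP[/eqP rxy cxy]; rewrite -ltnS (TP x) ?ltn_ord //.
  by apply: leq_ltn_trans cxy _; rewrite rxy -(TP y).
apply/implyP => /andP[/eqP cxy rxy]; rewrite (TP x _ (ltnW (ltn_ord (T y)))).
have : col y < g (T y).+1 (row y) by rewrite -(TP y).
rewrite cxy => /leq_trans; apply.
apply: leq_trans (pattern_mono_row gP _ rxy) _; by case: gP => _ _ _; apply.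
Qed.

Lemma tableau_uniq g T T' : tableau_of g T -> tableau_of g T' -> T = T'.
Proof.
have le U U' : tableau_of g U -> tableau_of g U' -> forall x, U x <= U' x.
  by move=> h h' x; rewrite -ltnS (h x) ?ltn_ord // -(h' x) ?ltn_ord.
move=> h h'; apply/ffunP => x; apply/val_inj/eqP => /=.
by rewrite eqn_leq (le T) ?(le T').
Qed.

(** The number of entries equal to [v]. *)
Definition weight T (v : nat) : nat := \sum_(x : cell s) (T x == v :> nat).

Lemma rowsum_array T l N : size s <= N ->
  rowsum (array T) l N = \sum_(x : cell s) (T x < l).
Proof.
move=> sN; rewrite (@rowsum_cst0 _ _ (size s)) //; last first.
  by move=> r sr; rewrite /array part_default // big_ord0.
rewrite /rowsum /array -(@sum_cells s (fun r c => entry T r c < l : nat)).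
by apply: eq_bigr => x _; rewrite entryE.
Qed.

Lemma weightE T N v : size s <= N ->
  weight T v + rowsum (array T) v N = rowsum (array T) v.+1 N.
Proof.
move=> sN; rewrite !rowsum_array // -big_split /=; apply: eq_bigr => x _.
by rewrite ltnS; case: ltngtP.
Qed.

End Count.

(** * Alternants *)

Local Open Scope ring_scope.

Local Notation "m # s" := [multinom m (s i) | i < _]
  (at level 40, left associativity, format "m # s").

Section Alternant.
Variable k : nat.
Implicit Types (m : 'X_{1..k}) (s w : 'S_k).

(** The antisymmetrization of the monomial ['X_[m]]. *)
Definition alternant m : {mpoly int[k]} :=
  \sum_(w : 'S_k) (-1) ^+ w *: 'X_[m#w].

Lemma mpermD m m' w : (m + m')%MM#w = (m#w + m'#w)%MM.
Proof. by apply/mnmP => i; rewrite !mnmE. Qed.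

Lemma alternant_tperm m (i j : 'I_k) : i != j ->
  alternant (m#(tperm i j)) = - alternant m.
Proof.
move=> ij; rewrite /alternant -sumrN (reindex_inj (mulIg (tperm i j))) /=.
apply: eq_bigr => w _; rewrite -mpermM -mulgA tperm2 mulg1 -scaleNr;
  congr (_ *: _).
by rewrite odd_permM odd_tperm ij signr_addb /= expr1 mulrN1.
Qed.

(** Each permuted monomial of the alternant is multiplied by the copy of [p]
    permuted in the same way. *)
Lemma sym_alternant (I : finType) (P : pred I) (F : I -> 'X_{1..k}) m :
  let p := \sum_(x | P x) 'X_[F x] : {mpoly int[k]} in
  p \is symmetric -> p * alternant m = \sum_(x | P x) alternant (m + F x)%MM.
Proof.
move=> p /issymP psym; rewrite /alternant exchange_big mulr_sumr /=.
apply: eq_bigr => w _; rewrite -scalerAr -scaler_sumr; congr (_ *: _).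
rewrite -(psym (w^-1)%g) /p linear_sum mulr_suml; apply: eq_bigr => x _.
by rewrite /= msymX invgK mpermD mpolyXD mulrC.
Qed.

Lemma symmetric_adjacent (p : {mpoly int[k]}) :
  (forall i j : 'I_k, j = i.+1 :> nat -> msym (tperm i j) p = p) ->
  p \is symmetric.
Proof.
move=> adj.
have tp d (i j : 'I_k) : j = (i + d.+1)%N :> nat -> msym (tperm i j) p = p.
  elim: d i j => [|d IH] i j jE; first by apply: adj; rewrite jE addn1.
  have jk : (i + d.+1 < k)%N by have := ltn_ord j; lia.
  pose j' := Ordinal jk.
  have ij' : i != j' by rewrite -val_eqE /=; lia.
  have ij : i != j by rewrite -val_eqE /=; lia.
  have -> : tperm i j = (tperm i j' ^ tperm j' j)%g.
    by rewrite tpermJ tpermL tpermD // eq_sym.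
  have jS : j = j'.+1 :> nat by rewrite jE /= addnS.
  by rewrite conjgE tpermV !msymMm (adj _ _ jS) (IH i j' erefl) (adj _ _ jS).
apply/issymP => s; have [ts -> _] := prod_tpermP s.
elim: ts => [|[i j] ts IH]; first by rewrite big_nil msym1m.
rewrite big_cons msymMm /=; case: (ltngtP i j) => ij.
- by rewrite (tp (j - i).-1) ?IH //; lia.
- by rewrite tpermC (tp (i - j).-1) ?IH //; lia.
- by rewrite (ord_inj ij) tperm1 msym1m.
Qed.

(** Strictly decreasing exponent vectors. *)
Definition strict m : Prop := forall i j : 'I_k, (i < j)%N -> (m j < m i)%N.

Lemma increasing_perm w :
  (forall i j : 'I_k, (i < j)%N -> (w i < w j)%N) -> w = 1%g.
Proof.
move=> inc.
have ge (u : 'S_k) : (forall i j : 'I_k, (i < j)%N -> (u i < u j)%N) ->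
    forall n (i : 'I_k), i = n :> nat -> (i <= u i)%N.
  move=> uinc; elim=> [|n IH] i iE; first by rewrite iE.
  have nk : (n < k)%N by rewrite -iE in IH *; have := ltn_ord i; lia.
  have := uinc (Ordinal nk) i; have := IH (Ordinal nk) erefl; rewrite /= iE;
    lia.
apply/permP => i; rewrite perm1; apply/val_inj/eqP;
  rewrite eqn_leq /= (ge w inc i) // andbT.
have inv : forall i j : 'I_k, (i < j)%N -> ((w^-1)%g i < (w^-1)%g j)%N.
  move=> a b ab; rewrite ltnNge leq_eqVlt;
    apply/negP => /orP[/eqP/ord_inj/perm_inj E|/inc].
    by move: ab; rewrite E ltnn.
  by rewrite !permKV; lia.
by have := ge _ inv (w i) (w i) erefl; rewrite permK.
Qed.

Lemma strict_perm m m' w : strict m -> strict m' -> m#w = m' -> w = 1%g.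
Proof.
move=> sm sm' E; apply: increasing_perm => i j /sm'.
rewrite -E !mnmE => lt; case: (ltngtP (w i) (w j)) => // [/sm|/ord_inj e];
  last by move: lt; rewrite e ltnn.
by move: lt; lia.
Qed.

Lemma mcoeff_alternant m m' : strict m -> strict m' ->
  (alternant m)@_m' = (m == m')%:R.
Proof.
move=> sm sm'; rewrite /alternant raddf_sum (bigD1 1%g) //= big1 => [|w w1].
  by rewrite addr0 linearZ /= mperm1 mcoeffX odd_perm1 mul1r.
rewrite linearZ /= mcoeffX; case: eqP => [/(strict_perm sm sm') E|];
  rewrite ?mulr0 //.
by rewrite E eqxx in w1.
Qed.

End Alternant.

(** * The sign-reversing involution *)

Lemma funext2 (g g' : nat -> nat -> nat) : g =2 g' -> g = g'.
Proof. by move=> E; apply/funext => l; apply/funext => r; apply: E. Qed.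

(** The exponent vector with the first [k] values of [f]. *)
Definition expts k (f : nat -> nat) : 'X_{1..k} := [multinom f i | i < k].

Section Schur.
Variables (k : nat) (s : intpart).
Implicit Type T : {ffun cell s -> 'I_k}.

Lemma schurE : schur k s =
  \sum_(T : {ffun cell s -> 'I_k} | semistandard T) 'X_[expts k (weight T)].
Proof.
apply: eq_bigr => T _; rewrite mprodXE; congr 'X_[_]; apply/mnmP => i.
rewrite mnm_sumE mnmE; apply: eq_bigr => x _.
by rewrite mnm1E -val_eqE.
Qed.

(** The semistandard tableau with array [g]; [T] is a default value, not used
    when [g] is a pattern. *)
Definition rebuild T (g : nat -> nat -> nat) : {ffun cell s -> 'I_k} :=
  xget T [set T' | semistandard T' /\ tableau_of g T']%classic.

Lemma rebuildP T g : pattern k (part s) g ->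
  semistandard (rebuild T g) /\ array (rebuild T g) =2 g.
Proof.
move=> gP; have [T' ss' tT'] := tableau_exists gP.
have [|] := @xgetPex _ T [set T' | semistandard T' /\ tableau_of g T']%classic.
  by exists T'.
rewrite -/(rebuild T g) => ss tT; split=> // l r.
have [kl|lk] := leqP k l; last exact: (arrayE gP tT _ (ltnW lk)).
by rewrite array_ge //; case: gP => _ ->.
Qed.

Lemma array_inj T T' : semistandard T -> semistandard T' ->
  array T =2 array T' -> T = T'.
Proof.
move=> /arrayP h /arrayP h' E; apply: tableau_uniq h _.
by move=> x l lk; rewrite E h'.
Qed.

Section FlipWeight.
Variables (T T' : {ffun cell s -> 'I_k}) (v i U : nat).
Hypothesis E : array T' =2 flip v i U (array T).
Let N := (size s).+1.

Lemma flip_rowsum_other l : l != v.+1 ->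
  rowsum (array T') l N = rowsum (array T) l N.
Proof. by move=> lv; apply: eq_rowsum => r _; rewrite E flip_other. Qed.

Lemma weight_flip_other u : u != v -> u != v.+1 -> weight T' u = weight T u.
Proof.
move=> uv uv'; have := weightE T u (leqnSn _); have := weightE T' u (leqnSn _).
by rewrite -/N !flip_rowsum_other //; lia.
Qed.

Lemma weight_flip :
  [/\ (weight T v + rowsum (array T) v N = rowsum (array T) v.+1 N)%N,
      (weight T v.+1 + rowsum (array T) v.+1 N = rowsum (array T) v.+2 N)%N,
      (weight T' v + rowsum (array T) v N = rowsum (array T') v.+1 N)%N
    & (weight T' v.+1 + rowsum (array T') v.+1 N = rowsum (array T) v.+2 N)%N].
Proof.
split; try exact: weightE.
- by rewrite -flip_rowsum_other ?weightE //; lia.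
- by rewrite -(@flip_rowsum_other v.+2) ?weightE //; lia.
Qed.

End FlipWeight.

(** The full Bender-Knuth involution is the flip from row [0] on, where the
    only upper bound in row [0] comes from the next level. *)
Definition bender_knuth v T : {ffun cell s -> 'I_k} :=
  rebuild T (flip v 0 (array T v.+2 0) (array T)).

Section BenderKnuth.
Variable v : nat.
Hypothesis vk : (v.+1 < k)%N.

Lemma bender_knuthP T : semistandard T -> semistandard (bender_knuth v T) /\
  array (bender_knuth v T) =2 flip v 0 (array T v.+2 0) (array T).
Proof.
move=> /array_pattern gP; apply: rebuildP; apply: (flip_pattern gP) => //.
by case: gP.
Qed.

Lemma bender_knuthK T : semistandard T -> bender_knuth v (bender_knuth v T) = T.
Proof.
move=> ssT; have gP := array_pattern ssT.
have [ss1 E1] := bender_knuthP ssT; have [ss2 E2] := bender_knuthP ss1.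
have g1 : (array T v.+1 0 <= array T v.+2 0)%N by case: gP.
apply: array_inj => // l r; rewrite E2 (funext2 E1).
rewrite [X in flip _ _ X](@flip_other v 0 _ _ v.+2);
  last by rewrite eqn_leq ltnn.
exact: (flipK gP vk g1 (leqnn _)).
Qed.

Lemma bender_knuth_weight T : semistandard T ->
  weight (bender_knuth v T) v = weight T v.+1 /\
  weight (bender_knuth v T) v.+1 = weight T v.
Proof.
move=> ssT; have gP := array_pattern ssT.
have [ss1 E1] := bender_knuthP ssT; have [h1 h2 h3 h4] := weight_flip E1.
have z : array T v.+2 (size s).+1 = 0%N.
  apply/eqP; rewrite -leqn0 -(part_default (leqnSn (size s))).
  exact: pattern_le gP _ _.
have g1 : (array T v.+1 0 <= array T v.+2 0)%N by case: gP.
have := flip_rowsum gP vk g1 (leqnn _) _ (ltn0Sn (size s)) z.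
rewrite (eq_rowsum (h := array (bender_knuth v T)) (l' := v.+1));
  last by move=> r _; rewrite E1.
rewrite !rowsum0 (rowsumS _ v.+2 0) rowsum0 => /(_ (fun h => ltac:(done))); lia.
Qed.

End BenderKnuth.

Lemma schur_sym : schur k s \is symmetric.
Proof.
apply: symmetric_adjacent => i j jE; rewrite schurE linear_sum /=.
have ik : (i.+1 < k)%N by rewrite -jE.
rewrite (reindex_onto (bender_knuth i) (bender_knuth i)) /=; last first.
  by move=> T; exact: bender_knuthK.
have P T : semistandard (bender_knuth i T) &&
    (bender_knuth i (bender_knuth i T) == T) = semistandard T.
  apply/andP/idP => [[ss /eqP <-]|ss]; first by case: (bender_knuthP ik ss).
  by rewrite bender_knuthK ?eqxx //; case: (bender_knuthP ik ss).
rewrite (eq_bigl _ _ P); apply: eq_bigr => T ss.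
rewrite msymX tpermV; congr 'X_[_]; apply/mnmP => u; rewrite !mnmE.
have [w1 w2] := bender_knuth_weight ik ss; have [_ E] := bender_knuthP ik ss.
case: tpermP => [->|->|/eqP ui /eqP uj]; rewrite ?jE ?w1 ?w2 //.
by rewrite (weight_flip_other E) // -?jE val_eqE.
Qed.

Variable lam : nat -> nat.
Hypothesis lamP : forall v, (lam v.+1 <= lam v)%N.

(** The first violation [(v, i)], if there is one. *)
Definition first_pair T : nat * nat :=
  xget (0%N, 0%N) [set p | firstviol lam (array T) p.1 p.2]%classic.

(** The sign-reversing involution on tableaux that are not good. *)
Definition cancel_flip T : {ffun cell s -> 'I_k} :=
  let: (v, i) := first_pair T in
  rebuild T (flip v i (cap lam (array T) v i) (array T)).

Lemma cancel_flipP T : semistandard T -> ~ good lam (array T) -> exists v i,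
  [/\ first_pair T = (v, i), firstviol lam (array T) v i,
      semistandard (cancel_flip T)
    & array (cancel_flip T) =2 flip v i (cap lam (array T) v i) (array T)].
Proof.
move=> ss ng; have gP := array_pattern ss.
have [v [i fv]] := firstviol_exists gP lamP ng; exists v, i.
have E : first_pair T = (v, i).
  apply: xget_unique => //= -[v' i'] /= fv'; exact: firstviol_uniq fv' fv.
rewrite /cancel_flip E; split=> //.
  exact: (rebuildP T (flip_firstviol_pattern gP lamP fv)).1.
exact: (rebuildP T (flip_firstviol_pattern gP lamP fv)).2.
Qed.

Definition bad T := semistandard T && ~~ `[< good lam (array T) >].

Lemma badP T : bad T -> semistandard T /\ ~ good lam (array T).
Proof. by move=> /andP[ss /asboolPn]. Qed.

Lemma cancel_flip_bad T : bad T -> bad (cancel_flip T).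
Proof.
move=> /badP[ss ng]; have [v [i [_ fv ss' E]]] := cancel_flipP ss ng.
rewrite /bad ss'; apply/asboolPn => /(_ v i); rewrite (funext2 E).
by have [-> _ _] := flip_firstviol (array_pattern ss) lamP fv.
Qed.

Lemma cancel_flipK T : bad T -> cancel_flip (cancel_flip T) = T.
Proof.
move=> bT; have [ss ng] := badP bT; have [ss1 ng1] := badP (cancel_flip_bad bT).
have gP := array_pattern ss.
have [v [i [E0 fv _ E]]] := cancel_flipP ss ng.
have [v' [i' [E0' fv' ss2 E']]] := cancel_flipP ss1 ng1.
have := firstviol_uniq fv'; rewrite (funext2 E) =>
  /(_ _ _ (flip_firstviol gP lamP fv)).
case=> vv ii; subst v' i'; apply: array_inj => // l r.
by rewrite E' (funext2 E) cap_flip (flip_firstviolK gP lamP fv).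
Qed.

Let expo T : 'X_{1..k} :=
  (expts k (fun i => lam i + (k - i))%N + expts k (weight T))%MM.

Lemma cancel_flip_alternant T : bad T ->
  alternant (expo (cancel_flip T)) = - alternant (expo T).
Proof.
move=> /badP[ss ng]; have gP := array_pattern ss.
have [v [i [_ fv ss1 E]]] := cancel_flipP ss ng.
have vk := firstviol_lt gP lamP fv.
pose a : 'I_k := Ordinal (ltnW vk); pose b : 'I_k := Ordinal vk.
have ab : a != b by rewrite -val_eqE /=; lia.
rewrite -(alternant_tperm _ ab); congr alternant; apply/mnmP => u;
  rewrite !mnmE.
(* One row more than the shape has, so that the last row is empty. *)
have := flip_firstviol_rowsum gP lamP fv (part_default (leqnSn (size s))).
rewrite (eq_rowsum (h := array (cancel_flip T)) (l' := v.+1));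
  last by move=> r _; rewrite E.
have [h1 h2 h3 h4] := weight_flip E => h5.
case: tpermP => [->|->|/eqP ua /eqP ub] /=; try lia.
by rewrite (weight_flip_other E) // -?val_eqE.
Qed.

(** The product of a Schur polynomial and an alternant is a sum of alternants
    over the good tableaux. *)
Lemma schur_alternant :
  schur k s * alternant (expts k (fun i => lam i + (k - i))%N) =
  \sum_(T : {ffun cell s -> 'I_k} | semistandard T && `[< good lam (array T) >])
    alternant (expo T).
Proof.
rewrite schurE sym_alternant -?schurE; last exact: schur_sym.
rewrite (bigID (fun T : {ffun cell s -> 'I_k} =>
  `[< good lam (array T) >])) /= -[RHS]addr0; congr (_ + _).
(* The involution pairs opposite terms, and its fixed points contribute terms
   equal to their opposite: the sum over bad tableaux equals its opposite. *)
set X := LHS; have X2 : X = - X.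
  rewrite {1}/X (reindex_onto cancel_flip cancel_flip) /=;
    last exact: cancel_flipK.
  rewrite -sumrN; apply: eq_big => T.
    apply/andP/idP => [[b /eqP <-]|b]; first exact: cancel_flip_bad.
    by rewrite (cancel_flipK b) eqxx; split=> //; exact: cancel_flip_bad.
  move=> /andP[b /eqP e]; rewrite -cancel_flip_alternant //.
  by rewrite -e; apply: cancel_flip_bad.
apply/mpolyP => m; rewrite mcoeff0; move: (congr1 (mcoeff m) X2).
rewrite mcoeffN; lia.
Qed.

End Schur.

(** * Littlewood-Richardson tableaux *)

Lemma part_size (s : intpart) k : (size s <= k)%N = (part s k == 0%N).
Proof. by rewrite leqNgt -part_gt0 -leqNgt leqn0. Qed.

Lemma partS (s : intpart) v : (part s v.+1 <= part s v)%N.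
Proof. exact: part_mono. Qed.

Section Highest.
Variable s : intpart.

(** The array of the tableau in which all entries of row [r] are [r]. *)
Definition highest (l r : nat) : nat := if (r < l)%N then part s r else 0%N.

Lemma highest_pattern k : (size s <= k)%N -> pattern k (part s) highest.
Proof.
move=> sk; split=> [r|l r kl|l r|l r]; rewrite /highest //.
- by case: ltnP => // lr; rewrite part_default //; lia.
- by case: ltnP => // lr; rewrite (leqW lr).
- by rewrite ltnS; case: ltnP => // _; exact: partS.
Qed.

Lemma rowsum_highest_lt l l' i : (i <= l)%N -> (i <= l')%N ->
  rowsum highest l i = rowsum highest l' i.
Proof.
move=> il il'; apply: eq_rowsum => r ri.
by rewrite /highest (leq_trans ri il) (leq_trans ri il').
Qed.

Lemma rowsum_highest_ge l i j : (l <= i)%N -> (l <= j)%N ->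
  rowsum highest l i = rowsum highest l j.
Proof.
have z r : (l <= r)%N -> highest l r = 0%N.
  by rewrite /highest leqNgt => /negbTE ->.
by move=> li lj; rewrite (rowsum_cst0 z li) (rowsum_cst0 z lj).
Qed.

Lemma rowsum_highestS l N : (l < N)%N ->
  rowsum highest l.+1 N = (rowsum highest l N + part s l)%N.
Proof.
move=> lN; rewrite (rowsum_highest_ge lN (leqnn _)) rowsumS {2}/highest leqnn.
rewrite (rowsum_highest_lt (leqnSn l) (leqnn l)).
by rewrite (rowsum_highest_ge (leqnn l) (ltnW lN)).
Qed.

Lemma highest_good : good (fun=> 0%N) highest.
Proof.
move=> v i; rewrite /violates -leqNgt !add0n.
have [iv|vi] := leqP i v.
  have -> : rowsum highest v.+2 i.+1 = rowsum highest v.+1 i.+1.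
    by apply: rowsum_highest_lt; lia.
  suff -> : rowsum highest v.+1 i = rowsum highest v i by [].
  by apply: rowsum_highest_lt; lia.
have -> : rowsum highest v i = rowsum highest v i.+1.
  by apply: rowsum_highest_ge; lia.
have -> : rowsum highest v.+1 i = rowsum highest v.+1 i.+1.
  by apply: rowsum_highest_ge; lia.
rewrite (@rowsum_highestS v.+1) ?ltnS // (@rowsum_highestS v) ?(ltnW vi) //;
  last by lia.
by have := partS s v; lia.
Qed.

(** For [lam = 0] the conditions force, row after row, the letters of row [r] to
    be at most [r]; interlacing forces them to be at least [r]. *)
Lemma good_highest k g : pattern k (part s) g -> good (fun=> 0%N) g ->
  g =2 highest.
Proof.
move=> gP gg.
suff H r : forall l, g l r = highest l r by move=> l r; apply: H.
have [n rn] := ubnP r; elim: n r rn => // n IH r; rewrite ltnS => rn.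
(* The letters of row [r] are at most [r]: the row no longer grows after level
   [r + 1]. *)
have step d : g (r.+1 + d)%N r = g r.+1 r.
  elim: d => [|d <-]; rewrite ?addn0 // addnS addSn; set v := (r + d)%N.
  case: (gP) => _ _ g1 _; apply/eqP; rewrite eqn_leq g1 andbT.
  have := gg v r; rewrite /violates -leqNgt !add0n !rowsumS.
  have E l l' : (r <= l)%N -> (r <= l')%N -> rowsum g l r = rowsum g l' r.
    move=> rl rl'; rewrite (@eq_rowsum g highest l l); last by move=> j jr;
      apply: IH; lia.
    rewrite (@eq_rowsum g highest l' l'); last by move=> j jr; apply: IH; lia.
    exact: rowsum_highest_lt.
  rewrite (E v.+2 r) ?(E v.+1 r) ?(E v r) /v; lia.
move=> l; rewrite /highest; case: ltnP => rl;
  last by rewrite (pattern_above gP).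
have -> : part s r = g (r.+1 + (maxn k l - r.+1))%N r.
  by case: (gP) => _ gk _ _; rewrite gk //; lia.
by rewrite step -(subnKC rl) step.
Qed.

End Highest.

(** The vector [f + rho], with [rho] decreasing by one at each step. Taking
    [k - i] rather than [k - 1 - i] only multiplies alternants by the product
    of the variables. *)
Definition plus_rho k (f : nat -> nat) : 'X_{1..k} :=
  expts k (fun i => f i + (k - i))%N.

Lemma plus_rho_strict k (s : intpart) : strict (plus_rho k (part s)).
Proof.
by move=> i j ij; rewrite !mnmE; have := part_mono s (ltnW ij);
  have := ltn_ord j; lia.
Qed.

Lemma plus_rho_inj k (s t : intpart) : (size s <= k)%N -> (size t <= k)%N ->
  plus_rho k (part s) = plus_rho k (part t) -> s = t.
Proof.
move=> sk tk /mnmP E; apply: part_inj => r; have [kr|rk] := leqP k r.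
  by rewrite !part_default //; lia.
by have := E (Ordinal rk); rewrite !mnmE /=; lia.
Qed.

Lemma mcoeff_part k (s t : intpart) : (size s <= k)%N -> (size t <= k)%N ->
  (alternant (plus_rho k (part s)))@_(plus_rho k (part t)) = (s == t)%:R.
Proof.
move=> sk tk.
rewrite (mcoeff_alternant (@plus_rho_strict k s) (@plus_rho_strict k t)).
by congr ((nat_of_bool _)%:R); apply/eqP/eqP => [/(plus_rho_inj sk tk)|->].
Qed.

Lemma alternant_part_neq0 k (s : intpart) : (size s <= k)%N ->
  alternant (plus_rho k (part s)) != 0.
Proof.
move=> sk; apply/eqP => /(congr1 (mcoeff (plus_rho k (part s)))).
by rewrite mcoeff_part // mcoeff0 eqxx.
Qed.

Lemma schur_eq0 k (s : intpart) : (k < size s)%N -> schur k s = 0.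
Proof.
move=> ks; rewrite schurE big1 // => T /array_pattern gP.
have := pattern_above gP (leqnn k); case: (gP) => _ -> // _ _ E.
by move: ks; rewrite -part_gt0 E.
Qed.

(** The alternant [A(rho)], the Vandermonde determinant times the product of
    the variables. *)
Definition vandermonde k : {mpoly int[k]} := alternant (plus_rho k (fun=> 0%N)).

(** The bialternant formula. *)
Lemma schur_vandermonde k (s : intpart) : (size s <= k)%N ->
  schur k s * vandermonde k = alternant (plus_rho k (part s)).
Proof.
move=> sk; rewrite schur_alternant //.
have [T ssT tT] := tableau_exists (highest_pattern sk).
have aT : array T =2 highest s.
  move=> l r; have [kl|lk] := leqP k l;
    last exact: (arrayE (highest_pattern sk) tT _ (ltnW lk)).
  by rewrite array_ge //; case: (highest_pattern sk) => _ ->.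
rewrite (big_pred1 T) => [|T'].
  congr alternant; apply/mnmP => i; rewrite !mnmE add0n addnC; congr addn.
  have := weightE T i (leq_addr i.+1 (size s));
    rewrite (funext2 aT) rowsum_highestS; lia.
apply/andP/eqP => [[ss' /asboolP gd]|->].
  apply: array_inj => // l r; rewrite aT;
    exact: (good_highest (array_pattern ss') gd).
by split=> //; apply/asboolP; rewrite (funext2 aT); exact: highest_good.
Qed.

Definition empty_part : intpart := @IntPart [::] isT.

Lemma vandermonde_neq0 k : vandermonde k != 0.
Proof.
have -> : vandermonde k = alternant (plus_rho k (part empty_part));
  last exact: alternant_part_neq0.
by congr alternant; apply/mnmP => i; rewrite !mnmE /part nth_nil.
Qed.

Lemma schur_neq0 k (s : intpart) : (size s <= k)%N -> schur k s != 0.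
Proof.
move=> sk; apply/eqP => z; have := alternant_part_neq0 sk.
by rewrite -schur_vandermonde // z mul0r eqxx.
Qed.

(** A decreasing sequence that vanishes eventually comes from a partition. *)
Lemma part_exists (f : nat -> nat) N :
  (forall v, f v.+1 <= f v)%N -> f N = 0%N -> {s : intpart | part s =1 f}.
Proof.
move=> fS fN; have ex : exists n, f n == 0%N by exists N; rewrite fN.
case: (ex_minnP ex) => n /eqP fn nmin.
have mono : {homo f : i j / (i <= j)%N >-> (j <= i)%N}.
  move=> i j /subnK <-; elim: (j - i)%N => // d IH.
  by rewrite addSn; apply: leq_trans IH.
have P : is_part (mkseq f n).
  apply/andP; split.
    by apply/(sortedP 0%N) => i; rewrite size_mkseq => ? /=;
      rewrite !nth_mkseq ?fS // ltnW.
  apply/negP => /mapP[i]; rewrite mem_iota add0n => /andP[_ lt] /esym/eqP /nmin;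
    lia.
exists (IntPart P) => r; rewrite /part /=; have [nr|rn] := leqP n r.
  by rewrite nth_default ?size_mkseq //; have := mono _ _ nr; lia.
by rewrite nth_mkseq.
Qed.

Section LRTableaux.
Variables (k : nat) (a b : intpart).
Implicit Type T : {ffun cell b -> 'I_k}.

(** Tableaux counted by the Littlewood-Richardson rule, for the inner
    partition [a]. *)
Definition goodtab T := semistandard T && `[< good (part a) (array T) >].

(** The partition [a + weight T]; [a] is a default value, not used for good
    tableaux ([outerE]). *)
Definition outer T : intpart :=
  xget a [set m : intpart |
    forall v, part m v = (part a v + weight T v)%N]%classic.

(** The Littlewood-Richardson tableaux of shape [b] and weight [m - a]. *)
Definition LRtab (m : intpart) T := goodtab T && (outer T == m).

Hypothesis ak : (size a <= k)%N.

Lemma weight_ge T v : (k <= v)%N -> weight T v = 0%N.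
Proof.
by move=> kv; rewrite /weight big1 // => x _; have := ltn_ord (T x);
  case: eqP => //; lia.
Qed.

Lemma outerE T : goodtab T ->
  part (outer T) =1 (fun v => part a v + weight T v)%N.
Proof.
move=> /andP[ss /asboolP gd].
have [||m mE] := @part_exists (fun v => part a v + weight T v)%N k.
- move=> v; pose N := (size b).+1.
  have w1 := weightE T v (leqnSn _); have w2 := weightE T v.+1 (leqnSn _).
  have z l : array T l (size b) = 0%N.
    by rewrite /array part_default // big_ord0.
  have := gd v (size b); rewrite /violates -leqNgt; move: w1 w2;
    rewrite !rowsumS !z; lia.
- by rewrite weight_ge // part_default.
by apply: (@xgetI _ a [set m : intpart |
  forall v, part m v = (part a v + weight T v)%N]%classic m).
Qed.

Lemma outer_size T : goodtab T -> (size (outer T) <= k)%N.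
Proof. by move=> gd; rewrite part_size outerE // weight_ge // part_default. Qed.

Lemma LRtabP m T : reflect [/\ semistandard T, good (part a) (array T) &
   forall v, part m v = (part a v + weight T v)%N] (LRtab m T).
Proof.
apply: (iffP andP) => [[gd /eqP <-]|[ss gd mE]].
  by case/andP: (gd) => ss /asboolP ?; split=> // v; apply: outerE.
have gT : goodtab T by rewrite /goodtab ss; apply/asboolP.
by split=> //; apply/eqP/part_inj => v; rewrite outerE.
Qed.

Lemma schur_mul_alternant :
  schur k a * schur k b * vandermonde k =
  \sum_(T | goodtab T) alternant (plus_rho k (part (outer T))).
Proof.
rewrite mulrAC schur_vandermonde // mulrC schur_alternant; last exact: partS.
apply: eq_bigr => T gd; congr alternant; apply/mnmP => i;
  rewrite !mnmE outerE //; lia.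
Qed.

Lemma schur_mul :
  schur k a * schur k b = \sum_(T | goodtab T) schur k (outer T).
Proof.
apply: (mulIf (vandermonde_neq0 k)); rewrite schur_mul_alternant mulr_suml.
by apply: eq_bigr => T gd; rewrite schur_vandermonde // outer_size.
Qed.

Lemma mcoeff_schur_mul (m : intpart) : (size m <= k)%N ->
  (schur k a * schur k b * vandermonde k)@_(plus_rho k (part m)) =
  #|LRtab m|%:R.
Proof.
move=> mk; rewrite schur_mul_alternant raddf_sum /=.
rewrite (eq_bigr (fun T => (outer T == m)%:R)); last first.
  by move=> T gd; rewrite mcoeff_part // outer_size.
rewrite -sum1_card natr_sum.
rewrite [RHS](eq_bigl (fun T => goodtab T && (outer T == m))) //.
by rewrite [RHS]big_mkcondr; apply: eq_bigr => T _; case: eqP.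
Qed.

End LRTableaux.

(** * Littlewood-Richardson coefficients *)

(** The number of Littlewood-Richardson tableaux with entries below [k]. *)
Definition LRcount k (a b m : intpart) : nat := #|@LRtab k a b m|.

Section Widen.
Variables (k k' : nat) (a b m : intpart).
Hypotheses (ak : (size a <= k)%N) (mk : (size m <= k)%N) (kk : (k <= k')%N).

Definition widen (T : {ffun cell b -> 'I_k}) : {ffun cell b -> 'I_k'} :=
  [ffun x => widen_ord kk (T x)].

Lemma widen_array T : array (widen T) =2 array T.
Proof.
move=> l r; apply: eq_bigr => c _.
have [x [rx cx] ->] := entry_at (widen T) (ltn_ord c).
by rewrite ffunE /= -(_ : entry T r c = T x) // -entryE rx cx.
Qed.

Lemma widen_weight T : weight (widen T) =1 weight T.
Proof. by move=> v; apply: eq_bigr => x _; rewrite ffunE. Qed.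

Lemma widen_semistandard T : semistandard (widen T) = semistandard T.
Proof.
by apply: eq_forallb => x; apply: eq_forallb => y; rewrite !ffunE.
Qed.

Lemma widen_inj : injective widen.
Proof.
move=> T T' /ffunP E; apply/ffunP => x; apply: val_inj.
by have /(congr1 val) := E x; rewrite !ffunE.
Qed.

Lemma widen_LRtab T : LRtab a m (widen T) = LRtab a m T.
Proof.
have ak' := leq_trans ak kk.
apply/(LRtabP ak')/(LRtabP ak) => -[ss gd mE]; split=> //.
- by rewrite -widen_semistandard.
- by rewrite -(funext2 (widen_array T)).
- by move=> v; rewrite mE widen_weight.
- by rewrite widen_semistandard.
- by rewrite (funext2 (widen_array T)).
- by move=> v; rewrite mE widen_weight.
Qed.

(** A tableau of weight [m - a] has no entry beyond the size of [m]. *)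
Lemma LRcount_widen : LRcount k a b m = LRcount k' a b m.
Proof.
rewrite /LRcount -(fintype.card_image widen_inj); apply: eq_card => T'.
apply/fintype.imageP/idP => [[T LT ->]|LT']; first by move: LT;
  rewrite /in_mem /= widen_LRtab.
have /(LRtabP (leq_trans ak kk))[_ _ mE] := LT'.
have lt x : (T' x < k)%N.
  rewrite ltnNge; apply/negP => kx.
  have := mE (T' x); rewrite (part_default (leq_trans mk kx)).
  by rewrite /weight (bigD1 x) //= eqxx; lia.
have E : T' = widen [ffun x => Ordinal (lt x)].
  by apply/ffunP => x; rewrite !ffunE; apply: val_inj.
by exists [ffun x => Ordinal (lt x)] => //; move: LT';
  rewrite {1}E /in_mem /= widen_LRtab.
Qed.

End Widen.

Lemma LRcount_stable k k' (a b m : intpart) :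
  (size a <= k)%N -> (size m <= k)%N -> (size a <= k')%N -> (size m <= k')%N ->
  LRcount k a b m = LRcount k' a b m.
Proof.
move=> ak mk ak' mk'; have [kk|kk] := leqP k k'; first exact: LRcount_widen.
by apply/esym/LRcount_widen => //; apply: ltnW.
Qed.

Lemma LRcount_size k (a b m : intpart) : (size a <= k)%N ->
  LRcount k a b m != 0%N -> forall v, (part a v <= part m v)%N.
Proof.
move=> ak; rewrite -lt0n => /card_gt0P[T /(LRtabP ak)[_ _ mE]] v.
by rewrite mE leq_addr.
Qed.

(** A sum over all partitions is a sum over a finite support, or [0] by
    convention. *)
Lemma finite_support_sum (V : nmodType) (F : intpart -> V) :
  \sum_(m \in [set: intpart]%classic) F m = 0 \/
  exists2 r : seq intpart, uniq r /\ (forall m, m \notin r -> F m = 0) &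
    \sum_(m \in [set: intpart]%classic) F m = \sum_(m <- r) F m.
Proof.
case: finite_supportP => [|X XT X0 _]; first by left; rewrite big_nil.
right; exists X => //; split; first exact: fset_uniq.
by move=> m; apply: X0.
Qed.

(** Uniqueness of the expansion: the coefficient of [s_m] is read off as the
    coefficient of the monomial with exponent [m + rho] in
    [s_a s_b A(rho)]. *)
Lemma schur_expansion_coef k (a b m : intpart) (c : intpart -> int) :
  schur_expansion a b c ->
  (size a <= k)%N -> (size b <= k)%N -> (size m <= k)%N ->
  c m = (LRcount k a b m)%:R.
Proof.
move=> ex ak bk mk; rewrite -mcoeff_schur_mul //.
(* If the support were infinite, the sum would be [0]; but [k] variables are
   enough for [s_a s_b] not to vanish. *)
have [E|[r [ur r0] E]] := finite_support_sum (fun m => schur k m *~ c m).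
  have /eqP := ex k; rewrite E mulf_eq0.
  by rewrite (negbTE (schur_neq0 ak)) (negbTE (schur_neq0 bk)).
rewrite ex E mulr_suml raddf_sum /=.
have term (m' : intpart) :
    (schur k m' *~ c m' * vandermonde k)@_(plus_rho k (part m)) =
    if m' == m then c m' else 0.
  have [mk'|km'] := leqP (size m') k.
    rewrite mulrzAl schur_vandermonde // raddfMz /= mcoeff_part //.
    by case: eqP => _; rewrite ?mul0rz ?intz.
  rewrite schur_eq0 // mul0rz mul0r mcoeff0; case: eqP => // E'.
  by move: km'; rewrite E' ltnNge mk.
rewrite (eq_bigr _ (fun m' _ => term m')) -big_mkcond /=.
have [mr|mr] := boolP (m \in r).
  by rewrite (big_rem m) //= eqxx big_seq_cond big1 ?addr0 // => i /andP[];
    rewrite mem_rem_uniq // inE => /andP[/negbTE ->].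
rewrite big_seq_cond big1; last by move=> i /andP[ir /eqP im];
  rewrite -im ir in mr.
by have := term m; rewrite (r0 m mr) mul0r mcoeff0 eqxx => <-.
Qed.

(** The coefficients given by the rule, in a number of variables that depends
    on [m] only through its size. *)
Definition LRnum (a b m : intpart) : int :=
  (LRcount (maxn (size a) (size m)) a b m)%:R.

(** Existence of the expansion. If [k] is too small for [s_a], both sides
    vanish, since [a] is contained in every [m] with a nonzero coefficient. *)
Lemma LRnum_expansion a b : schur_expansion a b (LRnum a b).
Proof.
move=> k; have [ak|ka] := leqP (size a) k; last first.
  rewrite schur_eq0 // mul0r fsbig1 // => m _.
  have [/schur_eq0 -> |mk] := ltnP k (size m); first by rewrite mul0rz.
  rewrite /LRnum; have [->|/LRcount_size nz] :=
    eqVneq (LRcount (maxn (size a) (size m)) a b m) 0%N.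
    by rewrite mulr0z.
  have := nz (leq_maxl _ _) (size m); rewrite (part_default (leqnn (size m))).
  by have := part_gt0 a (size m); lia.
rewrite schur_mul //.
have term (m : intpart) : schur k m *~ LRnum a b m =
    \sum_(T : {ffun cell b -> 'I_k} | goodtab a T)
      if outer a T == m then schur k m else 0.
  rewrite -big_mkcondr /= sumr_const.
  rewrite (_ : #|_| = LRcount k a b m); last by [].
  have [/schur_eq0 -> |mk] := ltnP k (size m); first by rewrite mul0rz mul0rn.
  by rewrite /LRnum natz -pmulrn (@LRcount_stable _ k) ?leq_maxl ?leq_maxr.
under eq_fsbigr => m _ do rewrite term.
pose r := undup [seq outer a T | T <- enum {ffun cell b -> 'I_k}].
have mr (T : {ffun cell b -> 'I_k}) : outer a T \in r.
  by rewrite mem_undup; apply/mapP; exists T; rewrite // mem_enum.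
rewrite (fsbigE r) ?undup_uniq //; last first.
  by move=> m _ mr'; apply: big1 => T _; case: eqP => // E;
    rewrite -E mr in mr'.
rewrite (eq_bigl xpredT) => [|m]; last by rewrite in_setT.
rewrite exchange_big /=; apply: eq_bigr => T _.
rewrite -big_mkcond /= (big_rem _ (mr T)) /= eqxx big_seq_cond big1 ?addr0 //.
by move=> i; rewrite mem_rem_uniq ?undup_uniq // inE eq_sym =>
  /andP[/andP[/negbTE ->]].
Qed.

Lemma LRcoefE k (a b m : intpart) : (size a <= k)%N -> (size m <= k)%N ->
  LRcoef a b m = (LRcount k a b m)%:R.
Proof.
move=> ak mk; have ex : schur_expansion a b (LRcoef a b).
  by apply: (@xgetPex _ (fun=> 0) [set c | schur_expansion a b c]%classic);
    exists (LRnum a b); exact: LRnum_expansion.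
rewrite (schur_expansion_coef ex (k := maxn k (size b)));
  rewrite ?leq_maxr ?leq_max ?ak ?mk //.
by congr (_%:R); apply: LRcount_stable; rewrite ?leq_max ?ak ?mk.
Qed.

Lemma LRcoef_ge0 a b m : 0 <= LRcoef a b m.
Proof. by rewrite (LRcoefE b (leq_maxl (size a) (size m)) (leq_maxr _ _)). Qed.

Lemma LRcoefC a b : LRcoef a b = LRcoef b a.
Proof.
by rewrite /LRcoef; congr xget; apply/predeqP => c; split=> h k;
  rewrite mulrC h.
Qed.

(** The arrays counted by the coefficient of [s_m] in [s_a s_b]. Every condition
    is preserved when two such arrays are added. *)
Definition LRpattern k (a b m : intpart) (g : nat -> nat -> nat) : Prop :=
  [/\ (size a <= k)%N, (size m <= k)%N, pattern k (part b) g, good (part a) g &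
     forall N v, (size b <= N)%N ->
       (part a v + rowsum g v.+1 N = part m v + rowsum g v N)%N].

(** The Littlewood-Richardson rule, in the form used for additivity. *)
Lemma LRcoef_gt0 a b m : 0 < LRcoef a b m <-> exists k g, LRpattern k a b m g.
Proof.
split=> [|[k [g [ak mk gP gd mE]]]].
  set k := maxn (size a) (size m); have ak : (size a <= k)%N := leq_maxl _ _.
  have mk : (size m <= k)%N := leq_maxr _ _.
  rewrite (LRcoefE b ak mk) ltr0n => /card_gt0P[T /(LRtabP ak)[ss gd mE]].
  exists k, (array T); split=> //; first exact: array_pattern.
  by move=> N v bN; rewrite mE -(weightE T v bN); lia.
rewrite (LRcoefE b ak mk) ltr0n; apply/card_gt0P.
have [T ss tT] := tableau_exists gP.
have E : array T =2 g.
  move=> l r; have [kl|lk] := leqP k l; last exact: (arrayE gP tT _ (ltnW lk)).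
  by rewrite array_ge //; case: gP => _ ->.
exists T; apply/(LRtabP ak); split=> //; first by rewrite (funext2 E).
move=> v; have := mE _ v (leqnn _).
by rewrite -(funext2 E) -(weightE T v (leqnn _)); lia.
Qed.

Lemma LRcoef_le a b m : LRcoef a b m != 0 -> forall v, (part a v <= part m v)%N.
Proof.
rewrite (LRcoefE b (leq_maxl (size a) (size m)) (leq_maxr _ _)) pnatr_eq0.
by move/LRcount_size; apply; apply: leq_maxl.
Qed.

(** The array [highest] is good for the empty inner partition. *)
Lemma LRcoef_empty (m : intpart) : 0 < LRcoef empty_part m m.
Proof.
apply/LRcoef_gt0; exists (size m), (highest m); split=> //;
  first exact: highest_pattern.
  have -> : part empty_part = fun=> 0%N; last exact: highest_good.
  by apply/funext => v; rewrite /part nth_nil.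
move=> N v mN; rewrite {1}/part nth_nil add0n.
have [vN|Nv] := ltnP v N; first by rewrite rowsum_highestS // addnC.
rewrite (@part_default m v) ?(leq_trans mN Nv) // add0n.
by apply: rowsum_highest_lt; rewrite // leqW.
Qed.

Lemma part_add_exists (a b : intpart) :
  {m : intpart | part m =1 (fun v => part a v + part b v)%N}.
Proof.
apply: (@part_exists _ (maxn (size a) (size b))) => [v|];
  first by rewrite leq_add ?partS.
by rewrite !part_default ?leq_maxl ?leq_maxr.
Qed.

Lemma LRcoef_add (a b m a' b' m' a'' b'' m'' : intpart) :
  (forall v, part a'' v = part a v + part a' v)%N ->
  (forall v, part b'' v = part b v + part b' v)%N ->
  (forall v, part m'' v = part m v + part m' v)%N ->
  0 < LRcoef a b m -> 0 < LRcoef a' b' m' -> 0 < LRcoef a'' b'' m''.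
Proof.
move=> aE bE mE /LRcoef_gt0[k [g [ak mk gP gd wE]]].
move=> /LRcoef_gt0[k' [g' [ak' mk' gP' gd' wE']]].
have up j j' f h : (j <= j')%N -> pattern j f h -> pattern j' f h.
  by move=> jj [h0 h1 h2 h3]; split=> // l r /(leq_trans jj)/h1.
have kK : (k <= maxn k k')%N := leq_maxl _ _;
  have kK' : (k' <= maxn k k')%N := leq_maxr _ _.
apply/LRcoef_gt0; exists (maxn k k'), (fun l r => g l r + g' l r)%N; split.
- by rewrite part_size aE !part_default ?(leq_trans ak) ?(leq_trans ak').
- by rewrite part_size mE !part_default ?(leq_trans mk) ?(leq_trans mk').
- have -> : part b'' = (fun v => part b v + part b' v)%N by apply/funext.
  by apply: patternD; [exact: up gP | exact: up gP'].
- have -> : part a'' = (fun v => part a v + part a' v)%N by apply/funext.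
  exact: goodD.
move=> N v; rewrite part_size bE addn_eq0 -!part_size => /andP[bN bN'].
by rewrite !rowsumD aE mE; have := wE N v bN; have := wE' N v bN'; lia.
Qed.

(** * Newell-Littlewood numbers *)

(** There are finitely many partitions contained in a given one. *)
Lemma finite_contained (m : intpart) :
  finite_set [set s : intpart | forall v, (part s v <= part m v)%N]%classic.
Proof.
pose M := (size m + part m 0)%N.
pose phi (f : {ffun 'I_M -> 'I_M.+1}) : intpart :=
  xget m [set s : intpart |
    (size s <= M)%N /\ forall i : 'I_M, part s i = f i]%classic.
apply: (@sub_finite_set _ _ (phi @` setT)%classic);
  last exact/finite_image/finite_finset.
move=> s /= sm; exists [ffun i : 'I_M => inord (part s i)] => //.
have sM : (size s <= M)%N.
  by rewrite part_size; have := sm M; rewrite (@part_default m M) ?leq_addr //;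
    lia.
have lt i : (part s i < M.+1)%N.
  by have := sm i; have := part_mono m (leq0n i); rewrite /M; lia.
apply: xget_unique => /= [|t [tM tE]].
  by split=> // i; rewrite ffunE inordK.
apply: part_inj => r; have [Mr|rM] := leqP M r;
  first by rewrite !part_default ?(leq_trans _ Mr).
by rewrite (tE (Ordinal rM)) ffunE inordK.
Qed.

(** The summands of a Newell-Littlewood number. *)
Definition NLterm (mu nu la : intpart) (t : intpart * intpart * intpart) :
  int :=
  let: (a, b, g) := t in LRcoef a b mu * LRcoef a g nu * LRcoef b g la.

Lemma NLterm_ge0 mu nu la t : 0 <= NLterm mu nu la t.
Proof. by case: t => [[a b] g]; rewrite /NLterm !mulr_ge0 ?LRcoef_ge0. Qed.

Lemma NLterm_finite mu nu la :
  finite_set [set t | NLterm mu nu la t != 0]%classic.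
Proof.
pose S m := [set s : intpart | forall v, (part s v <= part m v)%N]%classic.
apply: (@sub_finite_set _ _ ((S mu `*` S mu) `*` S nu)%classic); last first.
  by do 2?apply: finite_setX; exact: finite_contained.
move=> [[a b] g] /=; rewrite !mulf_eq0 !negb_or => /andP[/andP[h1 h2] _].
split; first split; rewrite /S /=.
- exact: LRcoef_le h1.
- by rewrite LRcoefC in h1; exact: LRcoef_le h1.
- by rewrite LRcoefC in h2; exact: LRcoef_le h2.
Qed.

Lemma NLnumber_gt0 mu nu la : 0 < NLnumber mu nu la <->
  exists a b g, [/\ 0 < LRcoef a b mu, 0 < LRcoef a g nu & 0 < LRcoef b g la].
Proof.
have -> : NLnumber mu nu la =
    \sum_(t \in [set: intpart * intpart * intpart]%classic) NLterm mu nu la t.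
  by [].
split=> [|[a [b [g [h1 h2 h3]]]]].
  apply: contraPP => nex; rewrite fsbig1 ?ltxx // => -[[a b] g] _ /=.
  apply/eqP; apply: contrapT => /negP; rewrite !mulf_eq0 !negb_or =>
    /andP[/andP[h1 h2] h3].
  by apply: nex; exists a, b, g; rewrite !lt0r h1 h2 h3 !LRcoef_ge0.
pose t := (a, b, g).
have tpos : 0 < NLterm mu nu la t by rewrite /= !mulr_gt0.
rewrite fsbig_supp fsbig_finite /=; last first.
  by apply: sub_finite_set (NLterm_finite mu nu la) => u /= [_ /eqP].
rewrite (big_rem t) /=; last first.
  rewrite in_fset_set.
    apply/mem_set; split=> //= /eqP.
    by rewrite (Order.POrderTheory.gt_eqF tpos).
  by apply: sub_finite_set (NLterm_finite mu nu la) => u /= [_ /eqP].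
by apply: ltr_wpDr => //; apply: sumr_ge0 => u _; apply: NLterm_ge0.
Qed.

Lemma nth_filter_neq0 (s : seq nat) i : sorted geq s ->
  nth 0%N [seq x <- s | x != 0%N] i = nth 0%N s i.
Proof.
elim: s i => // x s IH i xs /=; case: (eqVneq x 0%N) => [x0|x0] /=.
  have z : forall y, y \in s -> y = 0%N.
    have tr : transitive geq by move=> u v w /= h1 h2; apply: leq_trans h2 h1.
    by move: xs; rewrite /= (path_sortedE tr) => /andP[/allP h _] y /h /=;
      rewrite x0; lia.
  rewrite (@eq_in_filter _ _ pred0 s) => [|y /z -> //];
    rewrite filter_pred0 nth_nil.
  case: i => [|i] /=; first by rewrite x0.
  have [si|is_] := leqP (size s) i; first by rewrite nth_default.
  by rewrite [RHS]z ?mem_nth.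
by case: i => [|i] //=; apply: IH; apply: path_sorted xs.
Qed.

Section Strip.
Variable n : nat.

Lemma part_strip (la : Par n) v :
  part (strip la) v = if insub v is Some i then la i else 0%N.
Proof.
have nthE (i : 'I_n) : nth 0%N [seq la i | i <- enum 'I_n] i = la i.
  by rewrite (nth_map i) ?size_enum_ord // nth_ord_enum.
rewrite /part /= nth_filter_neq0.
  case: insubP => [i _ <-|]; first exact: nthE.
  by rewrite -leqNgt => nv; rewrite nth_default // size_map size_enum_ord.
have /forallP la_ := coordsP la.
apply/(sortedP 0%N) => i; rewrite size_map size_enum_ord => iN.
have iN' : (i < n)%N by apply: ltnW.
rewrite (nthE (Ordinal iN)) (nthE (Ordinal iN')).
by have /forallP/(_ (Ordinal iN))/implyP := la_ (Ordinal iN'); apply;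
  rewrite /= leqnSn.
Qed.

Lemma part_stripD (x y : Par n) v :
  part (strip (x + y)) v = (part (strip x) v + part (strip y) v)%N.
Proof. by rewrite !part_strip; case: insubP => // i _ _; rewrite /= ffunE. Qed.

End Strip.

Lemma LR_NL n : {subset LR n <= NL n}.
Proof.
move=> [[mu nu] la]; rewrite !unfold_in => h; apply/NLnumber_gt0.
by exists empty_part, (strip mu), (strip nu); split=> //; exact: LRcoef_empty.
Qed.

Theorem corollary5p2 (n : nat) (hn : (1 <= n)%N) :
  Algebra.addr_closed (NL n) /\
  (Algebra.addr_closed (LR n) /\ {subset LR n <= NL n}).
Proof.
split; last first.
  split; last exact: LR_NL.
  move=> [[mu nu] la] [[mu' nu'] la']; rewrite !unfold_in /= => h h'.
  by apply: (LRcoef_add _ _ _ h h') => v; apply: part_stripD.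
move=> [[mu nu] la] [[mu' nu'] la']; rewrite !unfold_in /=.
move=> /NLnumber_gt0[a [b [g [h1 h2 h3]]]].
move=> /NLnumber_gt0[a' [b' [g' [h1' h2' h3']]]].
apply/NLnumber_gt0.
have [a2 aE] := part_add_exists a a'; have [b2 bE] := part_add_exists b b'.
have [g2 gE] := part_add_exists g g'; exists a2, b2, g2; split.
- exact: (LRcoef_add aE bE (part_stripD mu mu') h1 h1').
- exact: (LRcoef_add aE gE (part_stripD nu nu') h2 h2').
- exact: (LRcoef_add bE gE (part_stripD la la') h3 h3').
Qed.
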